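(* Let $\mathcal{C}$ be a monoidal category with coequalizers and $i:R\to S$ a Frobenius algebra extension in $\mathcal{C}$, with Frobenius pair $(\vartheta,e)$, such that $R$ is coflat and $S$ is coflat and left robust. Then the extension $i:R\to S$ is separable if and only if there exists a morphism $\alpha_0:\underline{1}\to S$ in $\mathcal{C}$ such that $$m_S(i\otimes\alpha_0)=m_S(\alpha_0\otimes i)\quad\text{and}\quad m^R_S\;\widehat{m_S(\mathrm{Id}_S\otimes\alpha_0)}\;e=\eta_S .$$
   Context: Monoidal categories are taken strict, with tensor product $\otimes$ and unit object $\underline{1}$; $m_A,\eta_A$ denote multiplication and unit of an algebra $A$. An object $X$ is coflat if both $X\otimes-$ and $-\otimes X$ preserve coequalizers. For an algebra $R$, a right $R$-module $(X,\nu^R_X)$ and a left $R$-module $(Y,\mu^R_Y)$, $q^R_{X,Y}:X\otimes Y\to X\otimes_RY$ is the coequalizer of $\nu^R_X\otimes\mathrm{Id}_Y$ and $\mathrm{Id}_X\otimes\mu^R_Y$. For $g:X\to X'$ right $R$-linear, $\hat g:X\otimes_RY\to X'\otimes_RY$ is given by $\hat gq^R_{X,Y}=q^R_{X',Y}(g\otimes\mathrm{Id}_Y)$; for $f:Y\to Y'$ left $R$-linear, $\tilde f$ is given by $\tilde fq^R_{X,Y}=q^R_{X,Y'}(\mathrm{Id}_X\otimes f)$. The isomorphisms $\Upsilon_X:X\otimes_RR\to X$, $\Upsilon'_Y:R\otimes_RY\to Y$ are determined by $\Upsilon_Xq^R_{X,R}=\nu^R_X$, $\Upsilon'_Yq^R_{R,Y}=\mu^R_Y$.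 A left $R$-module $Y$ is left robust if for all objects $M$ and right $R$-modules $X$ the morphism $\theta'_{M,X,Y}:(M\otimes X)\otimes_RY\to M\otimes(X\otimes_RY)$ determined by $\theta'_{M,X,Y}q^R_{M\otimes X,Y}=\mathrm{Id}_M\otimes q^R_{X,Y}$ is an isomorphism. An algebra extension $i:R\to S$ is an algebra morphism; $S$ is an $R$-bimodule via $i$. $S\otimes_RS$ is an $S$-bimodule via $\mu^S_{S\otimes_RS}(\mathrm{Id}_S\otimes q^R_{S,S})=q^R_{S,S}(m_S\otimes\mathrm{Id}_S)$ and $\nu^S_{S\otimes_RS}(q^R_{S,S}\otimes\mathrm{Id}_S)=q^R_{S,S}(\mathrm{Id}_S\otimes m_S)$; $m^R_S:S\otimes_RS\to S$ is determined by $m^R_Sq^R_{S,S}=m_S$. The extension $i$ is Frobenius if it has a Frobenius pair $(\vartheta,e)$: an $R$-bimodule morphism $\vartheta:S\to R$ and a morphism $e:\underline{1}\to S\otimes_RS$ in $\mathcal{C}$ with $\mu^S_{S\otimes_RS}(\mathrm{Id}_S\otimes e)=\nu^S_{S\otimes_RS}(e\otimes\mathrm{Id}_S)$, $\tilde\vartheta e=\Upsilon_S^{-1}\eta_S$, $\hat\vartheta e=\Upsilon'^{-1}_S\eta_S$. It is separable if there is $e':\underline{1}\to S\otimes_RS$ with $\mu^S_{S\otimes_RS}(\mathrm{Id}_S\otimes e')=\nu^S_{S\otimes_RS}(e'\otimes\mathrm{Id}_S)$ and $m^R_Se'=\eta_S$. *)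

(* Defs.v *)
From mathcomp Require Import ssreflect.

Set Implicit Arguments.
Unset Strict Implicit.
Unset Printing Implicit Defensive.

Declare Scope cat_scope.
Delimit Scope cat_scope with cat.
Local Open Scope cat_scope.

(** * Monoidal categories *)

Record Category := {
  ob :> Type;
  hom : ob -> ob -> Type;
  idm : forall X, hom X X;
  comp : forall X Y Z, hom Y Z -> hom X Y -> hom X Z;
  compA : forall W X Y Z (h : hom Y Z) (g : hom X Y) (f : hom W X),
    comp h (comp g f) = comp (comp h g) f;
  comp1m : forall X Y (f : hom X Y), comp (idm Y) f = f;
  compm1 : forall X Y (f : hom X Y), comp f (idm X) = f }.

Arguments hom {c} X Y.
Arguments idm {c} X.
Arguments comp {c X Y Z} g f.

Notation "g ∘ f" := (comp g f) (at level 40, left associativity) : cat_scope.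
Notation "'Id' X" := (idm X) (at level 10, X at level 9) : cat_scope.

Definition is_iso (C : Category) (X Y : C) (f : hom X Y) : Prop :=
  exists g : hom Y X, g ∘ f = Id X /\ f ∘ g = Id Y.

(* The associativity and unit constraints are explicit, with inverses marked
   by a prime; a strict monoidal category is the case where they are all
   identities, and the constraints below then disappear from every formula. *)
Record MonoidalCategory := {
  mcat :> Category;
  tens : mcat -> mcat -> mcat;
  tensm : forall X X' Y Y' : mcat,
    hom X X' -> hom Y Y' -> hom (tens X Y) (tens X' Y');
  unit_ob : mcat;
  tensm1 : forall X Y : mcat, tensm (Id X) (Id Y) = Id (tens X Y);
  tensm_comp : forall (X X' X'' Y Y' Y'' : mcat)
      (f : hom X X') (f' : hom X' X'') (g : hom Y Y') (g' : hom Y' Y''),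
    tensm (f' ∘ f) (g' ∘ g) = tensm f' g' ∘ tensm f g;
  asso : forall X Y Z : mcat, hom (tens (tens X Y) Z) (tens X (tens Y Z));
  asso' : forall X Y Z : mcat, hom (tens X (tens Y Z)) (tens (tens X Y) Z);
  assoK : forall X Y Z : mcat, asso' X Y Z ∘ asso X Y Z = Id _;
  assoK' : forall X Y Z : mcat, asso X Y Z ∘ asso' X Y Z = Id _;
  asso_nat : forall (X X' Y Y' Z Z' : mcat)
      (f : hom X X') (g : hom Y Y') (h : hom Z Z'),
    asso X' Y' Z' ∘ tensm (tensm f g) h = tensm f (tensm g h) ∘ asso X Y Z;
  lun : forall X : mcat, hom (tens unit_ob X) X;
  lun' : forall X : mcat, hom X (tens unit_ob X);
  lunK : forall X : mcat, lun' X ∘ lun X = Id _;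
  lunK' : forall X : mcat, lun X ∘ lun' X = Id _;
  lun_nat : forall (X Y : mcat) (f : hom X Y),
    lun Y ∘ tensm (Id unit_ob) f = f ∘ lun X;
  run : forall X : mcat, hom (tens X unit_ob) X;
  run' : forall X : mcat, hom X (tens X unit_ob);
  runK : forall X : mcat, run' X ∘ run X = Id _;
  runK' : forall X : mcat, run X ∘ run' X = Id _;
  run_nat : forall (X Y : mcat) (f : hom X Y),
    run Y ∘ tensm f (Id unit_ob) = f ∘ run X;
  pentagon : forall W X Y Z : mcat,
    asso W X (tens Y Z) ∘ asso (tens W X) Y Z =
    tensm (Id W) (asso X Y Z) ∘ asso W (tens X Y) Z ∘ tensm (asso W X Y) (Id Z);
  triangle : forall X Y : mcat,
    tensm (Id X) (lun Y) ∘ asso X unit_ob Y = tensm (run X) (Id Y) }.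

Arguments tens {m} X Y.
Arguments tensm {m X X' Y Y'} f g.
Arguments unit_ob {m}.
Arguments asso {m} X Y Z.
Arguments asso' {m} X Y Z.
Arguments lun {m} X.
Arguments lun' {m} X.
Arguments run {m} X.
Arguments run' {m} X.

Notation "X ⊗ Y" := (tens X Y) (at level 36, left associativity) : cat_scope.
Notation "f ⊗₁ g" := (tensm f g) (at level 36, left associativity) : cat_scope.
Notation "'𝟙'" := unit_ob : cat_scope.

Section MonoidalTheory.
Variable C : MonoidalCategory.
Implicit Types X Y Z : C.

Lemma tens1_comp X Y Y' Y'' (g' : hom Y' Y'') (g : hom Y Y') :
  Id X ⊗₁ (g' ∘ g) = (Id X ⊗₁ g') ∘ (Id X ⊗₁ g).
Proof. by rewrite -tensm_comp comp1m. Qed.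

Lemma comp_tens1 X Y Y' Y'' (g' : hom Y' Y'') (g : hom Y Y') :
  (g' ∘ g) ⊗₁ Id X = (g' ⊗₁ Id X) ∘ (g ⊗₁ Id X).
Proof. by rewrite -tensm_comp comp1m. Qed.

Lemma tens_swap X X' Y Y' (f : hom X X') (g : hom Y Y') :
  (Id X' ⊗₁ g) ∘ (f ⊗₁ Id Y) = (f ⊗₁ Id Y') ∘ (Id X ⊗₁ g).
Proof. by rewrite -!tensm_comp !comp1m !compm1. Qed.

Lemma asso'_nat X X' Y Y' Z Z' (f : hom X X') (g : hom Y Y') (h : hom Z Z') :
  asso' X' Y' Z' ∘ (f ⊗₁ (g ⊗₁ h)) = ((f ⊗₁ g) ⊗₁ h) ∘ asso' X Y Z.
Proof.
rewrite -[LHS]compm1 -(assoK' X Y Z) compA -[in LHS](compA _ _ (asso X Y Z)).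
by rewrite -asso_nat !compA assoK comp1m.
Qed.

Lemma lun'_nat X Y (f : hom X Y) : lun' Y ∘ f = (Id 𝟙 ⊗₁ f) ∘ lun' X.
Proof.
rewrite -[LHS]compm1 -(lunK' X) compA -[in LHS](compA _ _ (lun X)).
by rewrite -lun_nat !compA lunK comp1m.
Qed.

Lemma run'_nat X Y (f : hom X Y) : run' Y ∘ f = (f ⊗₁ Id 𝟙) ∘ run' X.
Proof.
rewrite -[LHS]compm1 -(runK' X) compA -[in LHS](compA _ _ (run X)).
by rewrite -run_nat !compA runK comp1m.
Qed.

Lemma tens1_inj X Y (f g : hom X Y) : f ⊗₁ Id 𝟙 = g ⊗₁ Id 𝟙 -> f = g.
Proof.
move=> E; rewrite -[f]compm1 -[g]compm1 -(runK' X) !compA -!run_nat.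
by rewrite E.
Qed.

Lemma onetens_inj X Y (f g : hom X Y) : Id 𝟙 ⊗₁ f = Id 𝟙 ⊗₁ g -> f = g.
Proof.
move=> E; rewrite -[f]compm1 -[g]compm1 -(lunK' X) !compA -!lun_nat.
by rewrite E.
Qed.

Lemma split_epi (X Y Z : C) (g : hom X Y) (g' : hom Y X) (f f' : hom Y Z) :
  g ∘ g' = Id Y -> f ∘ g = f' ∘ g -> f = f'.
Proof. by move=> E H; rewrite -[f]compm1 -[f']compm1 -E !compA H. Qed.

Lemma run_tens X Y : (Id X ⊗₁ run Y) ∘ asso X Y 𝟙 = run (X ⊗ Y).
Proof.
apply: tens1_inj.
rewrite -[LHS]comp1m -[RHS]comp1m -(assoK X Y 𝟙) -!compA; congr (_ ∘ _).
rewrite comp_tens1 compA asso_nat -(triangle (X ⊗ Y) 𝟙) compA.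
rewrite -tensm1 asso_nat -(triangle Y 𝟙) tens1_comp -!compA pentagon.
by rewrite -!compA.
Qed.

Lemma lun_tens X Y : lun (X ⊗ Y) ∘ asso 𝟙 X Y = lun X ⊗₁ Id Y.
Proof.
apply: onetens_inj; apply: (split_epi (assoK' 𝟙 (𝟙 ⊗ X) Y)).
have E : asso 𝟙 𝟙 X ⊗₁ Id Y ∘ (asso' 𝟙 𝟙 X ⊗₁ Id Y) = Id _.
  by rewrite -comp_tens1 assoK' tensm1.
apply: (split_epi E); rewrite -asso_nat -[RHS]compA -comp_tens1 triangle.
rewrite tens1_comp -!compA (compA (Id 𝟙 ⊗₁ asso 𝟙 X Y)) -pentagon.
by rewrite compA triangle -tensm1 asso_nat.
Qed.

Lemma lun'_tens X Y : asso' 𝟙 X Y ∘ lun' (X ⊗ Y) = lun' X ⊗₁ Id Y.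
Proof.
apply: (split_epi (lunK' (X ⊗ Y))); rewrite -compA lunK compm1.
apply: (split_epi (assoK' 𝟙 X Y)); rewrite assoK -compA lun_tens.
by rewrite -comp_tens1 lunK tensm1.
Qed.

Lemma run'_tens X Y : asso X Y 𝟙 ∘ run' (X ⊗ Y) = Id X ⊗₁ run' Y.
Proof.
apply: (split_epi (runK' (X ⊗ Y))); rewrite -compA runK compm1.
rewrite -run_tens compA -tens1_comp runK tensm1.
by rewrite comp1m.
Qed.

Lemma pentagon' W X Y Z :
  asso' (W ⊗ X) Y Z ∘ asso' W X (Y ⊗ Z) ∘ (Id W ⊗₁ asso X Y Z) =
  (asso' W X Y ⊗₁ Id Z) ∘ asso' W (X ⊗ Y) Z.
Proof.
apply: (split_epi (assoK' W (X ⊗ Y) Z)).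
have E : asso W X Y ⊗₁ Id Z ∘ (asso' W X Y ⊗₁ Id Z) = Id _.
  by rewrite -comp_tens1 assoK' tensm1.
apply: (split_epi E); rewrite -!compA (compA (Id W ⊗₁ _)) -pentagon !compA.
rewrite -(compA (asso' _ _ _ ⊗₁ _)) assoK compm1 -comp_tens1 assoK tensm1.
by rewrite -(compA (asso' _ _ _)) assoK compm1 assoK.
Qed.

Lemma triangle' X Y : asso X 𝟙 Y ∘ (run' X ⊗₁ Id Y) = Id X ⊗₁ lun' Y.
Proof.
rewrite -[LHS]comp1m -tensm1 -(lunK Y) tens1_comp -!compA.
by rewrite (compA _ (asso _ _ _)) triangle -comp_tens1 runK' tensm1 compm1.
Qed.

End MonoidalTheory.

(** * Coequalizers and coflat objects *)

Section Coequalizers.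
Variable C : MonoidalCategory.

(* The factorization is data; it is unique, so a coequalizer structure on a
   given cofork is unique up to functional extensionality. *)
Record IsCoequalizer (X Y Q : C) (f g : hom X Y) (q : hom Y Q) : Type := {
  coeq_eq : q ∘ f = q ∘ g;
  coeq_desc : forall (Z : C) (h : hom Y Z), h ∘ f = h ∘ g -> hom Q Z;
  coeq_descE : forall (Z : C) (h : hom Y Z) (e : h ∘ f = h ∘ g),
    coeq_desc e ∘ q = h;
  coeq_epi : forall (Z : C) (k k' : hom Q Z), k ∘ q = k' ∘ q -> k = k' }.

(* A choice of coequalizer for every parallel pair. *)
Record HasCoequalizers := {
  coeq_ob : forall X Y : C, hom X Y -> hom X Y -> C;
  coeq_map : forall (X Y : C) (f g : hom X Y), hom Y (coeq_ob f g);
  coeqP : forall (X Y : C) (f g : hom X Y), IsCoequalizer f g (coeq_map f g) }.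

Record Coflat (X : C) : Type := {
  coflat_l : forall (Y Z Q : C) (f g : hom Y Z) (q : hom Z Q),
    IsCoequalizer f g q ->
    IsCoequalizer (Id X ⊗₁ f) (Id X ⊗₁ g) (Id X ⊗₁ q);
  coflat_r : forall (Y Z Q : C) (f g : hom Y Z) (q : hom Z Q),
    IsCoequalizer f g q ->
    IsCoequalizer (f ⊗₁ Id X) (g ⊗₁ Id X) (q ⊗₁ Id X) }.

End Coequalizers.

(** * Algebras, modules and algebra extensions *)

Record Algebra (C : MonoidalCategory) := {
  alg_ob :> C;
  mul : hom (alg_ob ⊗ alg_ob) alg_ob;
  one : hom 𝟙 alg_ob;
  mulA : mul ∘ (mul ⊗₁ Id alg_ob) = mul ∘ (Id alg_ob ⊗₁ mul) ∘ asso _ _ _;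
  mul1 : mul ∘ (one ⊗₁ Id alg_ob) = lun alg_ob;
  mulr1 : mul ∘ (Id alg_ob ⊗₁ one) = run alg_ob }.

Arguments mul {C} a.
Arguments one {C} a.

Section Modules.
Variables (C : MonoidalCategory) (R : Algebra C).

Record RightModule := {
  rm_ob :> C;
  ract : hom (rm_ob ⊗ R) rm_ob;
  ractA : ract ∘ (ract ⊗₁ Id R) = ract ∘ (Id rm_ob ⊗₁ mul R) ∘ asso _ _ _;
  ract1 : ract ∘ (Id rm_ob ⊗₁ one R) = run rm_ob }.

Record LeftModule := {
  lm_ob :> C;
  lact : hom (R ⊗ lm_ob) lm_ob;
  lactA : lact ∘ (mul R ⊗₁ Id lm_ob) = lact ∘ (Id R ⊗₁ lact) ∘ asso _ _ _;
  lact1 : lact ∘ (one R ⊗₁ Id lm_ob) = lun lm_ob }.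

Definition right_linear (X X' : RightModule) (g : hom X X') : Prop :=
  g ∘ ract X = ract X' ∘ (g ⊗₁ Id R).

Definition left_linear (Y Y' : LeftModule) (f : hom Y Y') : Prop :=
  f ∘ lact Y = lact Y' ∘ (Id R ⊗₁ f).

Definition right_regular : RightModule :=
  {| rm_ob := R; ract := mul R; ractA := mulA R; ract1 := mulr1 R |}.

Definition left_regular : LeftModule :=
  {| lm_ob := R; lact := mul R; lactA := mulA R; lact1 := mul1 R |}.

Section TensorModule.
Variables (M : C) (X : RightModule).

Let tact : hom (M ⊗ X ⊗ R) (M ⊗ X) := (Id M ⊗₁ ract X) ∘ asso M X R.

Lemma tens_ractA :
  tact ∘ (tact ⊗₁ Id R) = tact ∘ (Id (M ⊗ X) ⊗₁ mul R) ∘ asso _ _ _.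
Proof.
rewrite /tact comp_tens1 !compA -(compA _ (asso M X R)) asso_nat !compA.
rewrite -tens1_comp ractA !tens1_comp.
rewrite -!(compA (Id M ⊗₁ ract X)); congr (_ ∘ _).
by rewrite -!compA (compA _ _ (asso _ _ _ ⊗₁ _)) -pentagon !compA -asso_nat tensm1.
Qed.

Lemma tens_ract1 : tact ∘ (Id (M ⊗ X) ⊗₁ one R) = run (M ⊗ X).
Proof.
by rewrite /tact -tensm1 -compA asso_nat compA -tens1_comp ract1 run_tens.
Qed.

Definition tens_rmodule : RightModule :=
  {| rm_ob := M ⊗ X; ract := tact; ractA := tens_ractA; ract1 := tens_ract1 |}.

End TensorModule.
End Modules.

Arguments ract {C R} r.
Arguments lact {C R} l.
Arguments right_linear {C R} X X' g.
Arguments left_linear {C R} Y Y' f.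

Record AlgebraExtension (C : MonoidalCategory) (R S : Algebra C) := {
  ext_hom :> hom R S;
  ext_mul : ext_hom ∘ mul R = mul S ∘ (ext_hom ⊗₁ ext_hom);
  ext_one : ext_hom ∘ one R = one S }.

Section ExtensionModules.
Variables (C : MonoidalCategory) (R S : Algebra C) (i : AlgebraExtension R S).

Let nu : hom (S ⊗ R) S := mul S ∘ (Id S ⊗₁ i).
Let mu : hom (R ⊗ S) S := mul S ∘ (i ⊗₁ Id S).

Lemma ext_ractA : nu ∘ (nu ⊗₁ Id R) = nu ∘ (Id S ⊗₁ mul R) ∘ asso _ _ _.
Proof.
rewrite /nu comp_tens1 -!compA (compA (Id S ⊗₁ i)).
rewrite tens_swap -!compA compA mulA -!compA; congr (_ ∘ _).
rewrite (compA (Id S ⊗₁ i)) -tens1_comp ext_mul tens1_comp -compA.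
by congr (_ ∘ _); rewrite -asso_nat -tensm_comp comp1m compm1.
Qed.

Lemma ext_ract1 : nu ∘ (Id S ⊗₁ one R) = run S.
Proof. by rewrite /nu -compA -tens1_comp ext_one mulr1. Qed.

Lemma ext_lactA : mu ∘ (mul R ⊗₁ Id S) = mu ∘ (Id R ⊗₁ mu) ∘ asso _ _ _.
Proof.
rewrite /mu -!compA -comp_tens1 ext_mul comp_tens1 compA mulA -!compA.
congr (_ ∘ _); rewrite tens1_comp !compA -tens_swap -!compA.
congr (_ ∘ _); rewrite asso_nat compA; congr (_ ∘ _).
by rewrite -tensm_comp compm1 comp1m.
Qed.

Lemma ext_lact1 : mu ∘ (one R ⊗₁ Id S) = lun S.
Proof. by rewrite /mu -compA -comp_tens1 ext_one mul1. Qed.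

Definition ext_rmodule : RightModule R :=
  {| rm_ob := S; ract := nu; ractA := ext_ractA; ract1 := ext_ract1 |}.

Definition ext_lmodule : LeftModule R :=
  {| lm_ob := S; lact := mu; lactA := ext_lactA; lact1 := ext_lact1 |}.

End ExtensionModules.

(** * Tensor products over an algebra *)

Section TensorOver.
Variables (C : MonoidalCategory) (Q : HasCoequalizers C) (R : Algebra C).

Section Objects.
Variables (X : RightModule R) (Y : LeftModule R).

Let f : hom (X ⊗ R ⊗ Y) (X ⊗ Y) := ract X ⊗₁ Id Y.
Let g : hom (X ⊗ R ⊗ Y) (X ⊗ Y) := (Id X ⊗₁ lact Y) ∘ asso X R Y.

Definition tensR : C := coeq_ob Q f g.
Definition quo : hom (X ⊗ Y) tensR := coeq_map Q f g.

Definition quoP : IsCoequalizer f g quo := coeqP Q f g.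

Definition balanced (Z : C) (h : hom (X ⊗ Y) Z) : Prop := h ∘ f = h ∘ g.

Definition tensR_desc (Z : C) (h : hom (X ⊗ Y) Z) (e : balanced h) :
  hom tensR Z := coeq_desc quoP e.

Lemma quo_balanced : balanced quo.
Proof. exact: coeq_eq quoP. Qed.

Lemma tensR_descE (Z : C) (h : hom (X ⊗ Y) Z) (e : balanced h) :
  tensR_desc e ∘ quo = h.
Proof. exact: coeq_descE. Qed.

Lemma tensR_epi (Z : C) (k k' : hom tensR Z) : k ∘ quo = k' ∘ quo -> k = k'.
Proof. exact: coeq_epi quoP _ _ _. Qed.

End Objects.

Lemma hat_balanced (X X' : RightModule R) (Y : LeftModule R) (g : hom X X') :
  right_linear X X' g -> balanced (X := X) (quo X' Y ∘ (g ⊗₁ Id Y)).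
Proof.
move=> gL; rewrite /balanced -compA -comp_tens1 gL comp_tens1 compA.
rewrite (quo_balanced X' Y) -!compA; congr (_ ∘ _).
by rewrite asso_nat !compA -tens_swap tensm1.
Qed.

Definition hat (X X' : RightModule R) (Y : LeftModule R) (g : hom X X')
    (gL : right_linear X X' g) : hom (tensR X Y) (tensR X' Y) :=
  tensR_desc (hat_balanced Y gL).

Lemma tilde_balanced (X : RightModule R) (Y Y' : LeftModule R) (f : hom Y Y') :
  left_linear Y Y' f -> balanced (Y := Y) (quo X Y' ∘ (Id X ⊗₁ f)).
Proof.
move=> fL; rewrite /balanced -compA tens_swap compA (quo_balanced X Y').
rewrite -!compA; congr (_ ∘ _).
by rewrite -tensm1 asso_nat !compA -!tens1_comp fL.
Qed.

Definition tilde (X : RightModule R) (Y Y' : LeftModule R) (f : hom Y Y')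
    (fL : left_linear Y Y' f) : hom (tensR X Y) (tensR X Y') :=
  tensR_desc (tilde_balanced X fL).

Lemma Upsilon_balanced (X : RightModule R) :
  balanced (X := X) (Y := left_regular R) (ract X).
Proof. by rewrite /balanced /= ractA compA. Qed.

Definition Upsilon (X : RightModule R) : hom (tensR X (left_regular R)) X :=
  tensR_desc (Upsilon_balanced X).

(* The explicit inverse of [Upsilon X]: see [UpsilonK] and [UpsilonK'] below. *)
Definition Upsilon_inv (X : RightModule R) :
    hom X (tensR X (left_regular R)) :=
  quo X (left_regular R) ∘ (Id X ⊗₁ one R) ∘ run' X.

Lemma UpsilonK (X : RightModule R) : Upsilon_inv X ∘ Upsilon X = Id _.
Proof.
apply: tensR_epi; rewrite comp1m -compA tensR_descE /Upsilon_inv.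
rewrite -!compA run'_nat (compA _ _ (run' _)) tens_swap !compA.
rewrite (quo_balanced X (left_regular R)) /= -tensm1.
rewrite -!compA (compA (asso _ _ _)) asso_nat !compA -(compA (quo _ _)).
rewrite -tens1_comp mulr1 -!compA run'_tens -tens1_comp runK' tensm1.
exact: compm1.
Qed.

Lemma UpsilonK' (X : RightModule R) : Upsilon X ∘ Upsilon_inv X = Id X.
Proof. by rewrite /Upsilon_inv !compA tensR_descE ract1 runK'. Qed.

Lemma Upsilon'_balanced (Y : LeftModule R) :
  balanced (X := right_regular R) (Y := Y) (lact Y).
Proof. by rewrite /balanced /= lactA compA. Qed.

Definition Upsilon' (Y : LeftModule R) : hom (tensR (right_regular R) Y) Y :=
  tensR_desc (Upsilon'_balanced Y).

Definition Upsilon'_inv (Y : LeftModule R) :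
    hom Y (tensR (right_regular R) Y) :=
  quo (right_regular R) Y ∘ (one R ⊗₁ Id Y) ∘ lun' Y.

Lemma Upsilon'K (Y : LeftModule R) : Upsilon'_inv Y ∘ Upsilon' Y = Id _.
Proof.
apply: tensR_epi; rewrite comp1m -compA tensR_descE /Upsilon'_inv.
rewrite -!compA lun'_nat (compA _ _ (lun' _)) -tens_swap.
have E : quo (right_regular R) Y ∘ (Id R ⊗₁ lact Y) =
    quo (right_regular R) Y ∘ (mul R ⊗₁ Id Y) ∘ asso' R R Y.
  by rewrite (quo_balanced (right_regular R) Y) -!compA assoK' compm1.
rewrite !compA E -!compA (compA (asso' _ _ _)) -tensm1 asso'_nat !compA.
rewrite -(compA (quo _ _)) -comp_tens1 mul1 -!compA lun'_tens.
rewrite -comp_tens1 lunK' tensm1; exact: compm1.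
Qed.

Lemma Upsilon'K' (Y : LeftModule R) : Upsilon' Y ∘ Upsilon'_inv Y = Id Y.
Proof. by rewrite /Upsilon'_inv !compA tensR_descE lact1 lunK'. Qed.

Lemma theta'_balanced (M : C) (X : RightModule R) (Y : LeftModule R) :
  balanced (X := tens_rmodule M X) (Y := Y) ((Id M ⊗₁ quo X Y) ∘ asso M X Y).
Proof.
rewrite /balanced /= comp_tens1 !compA -(compA _ (asso M X Y)) asso_nat compA.
rewrite -tens1_comp (quo_balanced X Y) !tens1_comp -!compA.
congr (_ ∘ _); rewrite (compA (Id M ⊗₁ asso X R Y)) -pentagon -tensm1 !compA.
by rewrite asso_nat.
Qed.

Definition theta' (M : C) (X : RightModule R) (Y : LeftModule R) :
    hom (tensR (tens_rmodule M X) Y) (M ⊗ tensR X Y) :=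
  tensR_desc (theta'_balanced M X Y).

Definition left_robust (Y : LeftModule R) : Prop :=
  forall (M : C) (X : RightModule R), is_iso (theta' M X Y).

End TensorOver.

(** * Frobenius and separable extensions *)

Section Extension.
Variables (C : MonoidalCategory) (Q : HasCoequalizers C) (R S : Algebra C).
Variables (i : AlgebraExtension R S) (cS : Coflat S).

Notation SR := (ext_rmodule i).
Notation RS := (ext_lmodule i).

Definition SS : C := tensR Q SR RS.
Definition qS : hom (S ⊗ S) SS := quo Q SR RS.

Lemma mul_ract : mul S ∘ (Id S ⊗₁ ract SR) =
  ract SR ∘ (mul S ⊗₁ Id R) ∘ asso' S S R.
Proof.
rewrite /= tens1_comp compA -(compA (mul S) (Id S ⊗₁ i)) tens_swap !compA mulA.
rewrite -tensm1 -!compA -asso'_nat !compA.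
by rewrite -(compA _ (asso _ _ _)) assoK' compm1.
Qed.

Lemma mul_lact : mul S ∘ (lact RS ⊗₁ Id S) =
  lact RS ∘ (Id R ⊗₁ mul S) ∘ asso R S S.
Proof.
rewrite /= comp_tens1 compA mulA -!compA; congr (_ ∘ _).
by rewrite asso_nat !compA tensm1 tens_swap.
Qed.

Lemma SS_lact_balanced :
  (qS ∘ (mul S ⊗₁ Id S) ∘ asso' S S S) ∘ (Id S ⊗₁ (ract SR ⊗₁ Id RS)) =
  (qS ∘ (mul S ⊗₁ Id S) ∘ asso' S S S) ∘
    (Id S ⊗₁ ((Id SR ⊗₁ lact RS) ∘ asso SR R RS)).
Proof.
have E : qS ∘ (Id S ⊗₁ lact RS) = qS ∘ (ract SR ⊗₁ Id S) ∘ asso' S R S.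
  by rewrite (quo_balanced Q SR RS) -!compA assoK' compm1.
rewrite -!compA asso'_nat [in LHS](compA (mul S ⊗₁ _)) -comp_tens1 mul_ract.
rewrite !comp_tens1 -!compA -pentagon' tens1_comp (compA (asso' S S S)).
rewrite asso'_nat tensm1 !compA -(compA qS (mul S ⊗₁ _)) -tens_swap !compA E.
rewrite -[in RHS]tensm1 -!compA (compA (asso' S R S)) asso'_nat.
by rewrite /= comp_tens1 -!compA.
Qed.

(* The left action determined by [SS_lactE]: since S is coflat,
   [Id S ⊗₁ qS] is again a coequalizer. *)
Definition SS_lact : hom (S ⊗ SS) SS :=
  coeq_desc (coflat_l cS (quoP Q SR RS)) SS_lact_balanced.

Lemma SS_lactE :
  SS_lact ∘ (Id S ⊗₁ qS) = qS ∘ (mul S ⊗₁ Id S) ∘ asso' S S S.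
Proof. exact: coeq_descE. Qed.

Lemma SS_ract_balanced :
  (qS ∘ (Id S ⊗₁ mul S) ∘ asso S S S) ∘ ((ract SR ⊗₁ Id RS) ⊗₁ Id S) =
  (qS ∘ (Id S ⊗₁ mul S) ∘ asso S S S) ∘
    (((Id SR ⊗₁ lact RS) ∘ asso SR R RS) ⊗₁ Id S).
Proof.
have E : qS ∘ (ract SR ⊗₁ Id S) = qS ∘ (Id S ⊗₁ lact RS) ∘ asso S R S.
  by rewrite (quo_balanced Q SR RS) -!compA.
rewrite -!compA asso_nat tensm1 (compA (Id S ⊗₁ mul S)) tens_swap !compA E.
rewrite comp_tens1 -!compA [in RHS](compA (asso S S S)) asso_nat.
rewrite !compA -[in RHS](compA qS) -tens1_comp mul_lact !tens1_comp -!compA.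
rewrite (compA (Id S ⊗₁ asso R S S)) -pentagon (compA _ (asso S R (S ⊗ S))).
by rewrite -asso_nat tensm1 !compA.
Qed.

Definition SS_ract : hom (SS ⊗ S) SS :=
  coeq_desc (coflat_r cS (quoP Q SR RS)) SS_ract_balanced.

Lemma SS_ractE :
  SS_ract ∘ (qS ⊗₁ Id S) = qS ∘ (Id S ⊗₁ mul S) ∘ asso S S S.
Proof. exact: coeq_descE. Qed.

Lemma mul_balanced : balanced (X := SR) (Y := RS) (mul S).
Proof.
rewrite /balanced /= comp_tens1 compA mulA -!compA asso_nat.
by rewrite (compA (Id S ⊗₁ mul S)) -tens1_comp.
Qed.

Definition mR : hom SS S := tensR_desc Q mul_balanced.

Definition right_mul (a : hom 𝟙 S) : hom S S :=
  mul S ∘ (Id S ⊗₁ a) ∘ run' S.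

Lemma right_mul_linear (a : hom 𝟙 S) :
  mul S ∘ (i ⊗₁ a) ∘ run' R = mul S ∘ (a ⊗₁ i) ∘ lun' R ->
  right_linear SR SR (right_mul a).
Proof.
move=> Ha; rewrite /right_linear /right_mul /=.
transitivity (mul S ∘ (Id S ⊗₁ (mul S ∘ (i ⊗₁ a) ∘ run' R))).
  rewrite -!compA run'_nat comp_tens1 -!compA (compA (Id S ⊗₁ a)) tens_swap.
  rewrite !compA mulA !tens1_comp -run'_tens -!compA.
  congr (_ ∘ (_ ∘ _)); rewrite !compA -asso_nat; congr (_ ∘ _).
  by rewrite -compA -tensm_comp comp1m compm1.
rewrite Ha !comp_tens1 -!compA (compA (Id S ⊗₁ i)) tens_swap.
rewrite !compA mulA !tens1_comp -triangle' -!compA.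
congr (_ ∘ (_ ∘ _)); rewrite !compA -asso_nat; congr (_ ∘ _).
by rewrite -compA -tensm_comp comp1m compm1.
Qed.

Definition casimir (e : hom 𝟙 SS) : Prop :=
  SS_lact ∘ (Id S ⊗₁ e) ∘ run' S = SS_ract ∘ (e ⊗₁ Id S) ∘ lun' S.

Definition separable : Prop :=
  exists e : hom 𝟙 SS, casimir e /\ mR ∘ e = one S.

Record BimoduleMorphism := {
  bim_hom :> hom S R;
  bim_left : left_linear RS (left_regular R) bim_hom;
  bim_right : right_linear SR (right_regular R) bim_hom }.

Record FrobeniusPair (th : BimoduleMorphism) (e : hom 𝟙 SS) : Prop := {
  frob_casimir : casimir e;
  frob_tilde : tilde Q SR (bim_left th) ∘ e = Upsilon_inv Q SR ∘ one S;
  frob_hat : hat Q RS (bim_right th) ∘ e = Upsilon'_inv Q RS ∘ one S }.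

End Extension.

Arguments separable {C} Q {R S} i cS.
Arguments FrobeniusPair {C} Q {R S i} cS th e.

(* Main.v *)
(* With elements: if [f = f1 ⊗_R f2] is Casimir with [f1 f2 = 1], take
   [a = f1 ϑ(f2)]. The Casimir identities of [f] and [e] give
   [e1 a ⊗ e2 = e1 f1 ⊗ ϑ(f2) e2 = f1 ⊗ ϑ(f2 e1) e2 = f1 ⊗ ϑ(e1) e2 f2 = f],
   so [a] is as wanted. Conversely [e1 a ⊗_R e2] is Casimir because right
   multiplication by [a] on the first factor is [S]-bilinear on [S ⊗_R S]. *)
From mathcomp Require Import ssreflect.
Require Import Defs.
Open Scope cat_scope.

Set Implicit Arguments.
Unset Strict Implicit.
Unset Printing Implicit Defensive.

(** After tensoring with [𝟙], [lun_tens] and [triangle] reduce this to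
    [lun (𝟙 ⊗ 𝟙) = Id 𝟙 ⊗₁ lun 𝟙], which is naturality of [lun] at the isomorphism [lun 𝟙]. *)
Lemma lun_run_unit (C : MonoidalCategory) : lun (unit_ob (m := C)) = run 𝟙.
Proof.
apply: tens1_inj; rewrite -lun_tens -triangle; congr (_ ∘ _).
by rewrite -[LHS]comp1m -[RHS]comp1m -(lunK 𝟙) -!compA lun_nat.
Qed.

Lemma lun'_run'_unit (C : MonoidalCategory) : lun' (unit_ob (m := C)) = run' 𝟙.
Proof. by rewrite -[LHS]comp1m -(runK 𝟙) -lun_run_unit -compA lunK' compm1. Qed.

Section FrobeniusSeparable.
Variables (C : MonoidalCategory) (Q : HasCoequalizers C) (R S : Algebra C).
Variables (i : AlgebraExtension R S) (cR : Coflat R) (cS : Coflat S).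

Notation SR := (ext_rmodule i).
Notation RS := (ext_lmodule i).
Notation SS := (SS Q i).
Notation qS := (qS Q i).
Notation lactS := (SS_lact Q i cS).
Notation ractS := (SS_ract Q i cS).

(** Balancing with a generalized element of [R]: [x h(z) ⊗_R y = x ⊗_R h(z) y]. It carries values of
    [ϑ] across the tensor sign. *)
Lemma qS_balanced (X : C) (h : hom X R) :
  qS ∘ ((ract SR ∘ (Id S ⊗₁ h)) ⊗₁ Id S) =
  qS ∘ (Id S ⊗₁ (lact RS ∘ (h ⊗₁ Id S))) ∘ asso S X S.
Proof.
have E : qS ∘ (ract SR ⊗₁ Id S) = qS ∘ ((Id S ⊗₁ lact RS) ∘ asso S R S).
  exact: (quo_balanced Q SR RS).
rewrite (comp_tens1 _ (ract SR)) compA E -!(compA qS) -(compA _ (asso _ _ _)).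
by rewrite asso_nat compA (tens1_comp _ (lact RS)) -[LHS]compA (compA (Id S ⊗₁ lact RS)) compA.
Qed.

Lemma SS_lact_epi (Z : C) (k k' : hom (S ⊗ SS) Z) :
  k ∘ (Id S ⊗₁ qS) = k' ∘ (Id S ⊗₁ qS) -> k = k'.
Proof. exact: coeq_epi (coflat_l cS (quoP Q SR RS)) _ _ _. Qed.

Lemma coflat_tens_epi (M Z : C) (cM : Coflat M) (k k' : hom (SS ⊗ M) Z) :
  k ∘ (qS ⊗₁ Id M) = k' ∘ (qS ⊗₁ Id M) -> k = k'.
Proof. exact: coeq_epi (coflat_r cM (quoP Q SR RS)) _ _ _. Qed.

Lemma SS_ractA :
  ractS ∘ (ractS ⊗₁ Id S) = ractS ∘ (Id SS ⊗₁ mul S) ∘ asso SS S S.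
Proof.
(* Coflatness of [S], used twice, reduces the claim to associativity of [mul S] in the last three of
   four factors. *)
have epi := coeq_epi (coflat_r cS (coflat_r cS (quoP Q SR RS))).
apply: epi; rewrite -!/(qS) -/(Defs.SS Q i).
rewrite -compA -comp_tens1 SS_ractE.
rewrite -[RHS]compA asso_nat tensm1 -!compA [in RHS](compA (_ ⊗₁ mul S)) tens_swap.
rewrite !compA SS_ractE !comp_tens1 !compA SS_ractE.
rewrite -[Id (SR ⊗ RS)]/(Id (S ⊗ S)) -tensm1 -!(compA _ (asso S S S)) !asso_nat.
rewrite !compA -!(compA qS) -!tens1_comp mulA !tens1_comp.
by rewrite -!compA; congr (_ ∘ (_ ∘ (_ ∘ _))); rewrite pentagon -!compA.
Qed.

Section HatLinear.
Variables (g : hom S S) (gL : right_linear SR SR g).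

Lemma hatE : hat Q RS gL ∘ qS = qS ∘ (g ⊗₁ Id S).
Proof. exact: (tensR_descE Q (hat_balanced Q RS gL)). Qed.

Lemma hat_ract : hat Q RS gL ∘ ractS = ractS ∘ (hat Q RS gL ⊗₁ Id S).
Proof.
apply: (coflat_tens_epi cS).
rewrite -!compA SS_ractE -comp_tens1 hatE comp_tens1 !compA hatE SS_ractE.
rewrite -!compA; congr (_ ∘ _).
by rewrite asso_nat !compA tensm1 tens_swap.
Qed.

Lemma hat_lact : g ∘ mul S = mul S ∘ (Id S ⊗₁ g) ->
  hat Q RS gL ∘ lactS = lactS ∘ (Id S ⊗₁ hat Q RS gL).
Proof.
move=> gS; apply: SS_lact_epi.
rewrite -!compA SS_lactE -tens1_comp hatE tens1_comp !compA hatE SS_lactE.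
rewrite -!compA; congr (_ ∘ _).
by rewrite asso'_nat !compA -!comp_tens1 gS.
Qed.

(** Both sides of the Casimir identity are carried along because [hat g] is [S]-bilinear: on the
    right since [g] touches only the first factor, on the left by [S]-linearity of [g]. *)
Lemma hat_casimir (e : hom 𝟙 SS) : g ∘ mul S = mul S ∘ (Id S ⊗₁ g) ->
  casimir cS e -> casimir cS (hat Q RS gL ∘ e).
Proof.
move=> gS eC; rewrite /casimir tens1_comp comp_tens1 !compA -hat_lact //.
by rewrite -hat_ract -!compA; congr (_ ∘ _); rewrite !compA.
Qed.

End HatLinear.

Lemma right_mul_mul (a : hom 𝟙 S) :
  right_mul a ∘ mul S = mul S ∘ (Id S ⊗₁ right_mul a).
Proof.
rewrite /right_mul -!compA run'_nat (compA (Id S ⊗₁ a)) tens_swap !compA mulA.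
rewrite !tens1_comp -run'_tens -!compA; congr (_ ∘ (_ ∘ _)).
by rewrite !compA -asso_nat tensm1.
Qed.

Variables (th : BimoduleMorphism i).

(* [x ⊗_R y ↦ x ϑ(y)] *)
Definition Theta : hom SS S := Upsilon Q SR ∘ tilde Q SR (bim_left th).

(* [x ⊗_R y ↦ ϑ(x) y] *)
Definition Theta' : hom SS S := Upsilon' Q RS ∘ hat Q RS (bim_right th).

Lemma ThetaE : Theta ∘ qS = ract SR ∘ (Id S ⊗₁ th).
Proof.
rewrite /Theta -compA (tensR_descE Q (tilde_balanced Q SR (bim_left th))) compA.
by rewrite (tensR_descE Q (Upsilon_balanced SR)).
Qed.

Lemma Theta'E : Theta' ∘ qS = lact RS ∘ (th ⊗₁ Id S).
Proof.
rewrite /Theta' -compA (tensR_descE Q (hat_balanced Q RS (bim_right th))) compA.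
by rewrite (tensR_descE Q (Upsilon'_balanced RS)).
Qed.

Lemma Theta_lact : Theta ∘ lactS = mul S ∘ (Id S ⊗₁ Theta).
Proof.
apply: SS_lact_epi; rewrite -!compA SS_lactE -tens1_comp !compA ThetaE.
rewrite tens1_comp compA mul_ract -!compA; congr (_ ∘ (_ ∘ _)).
by rewrite asso'_nat !compA tens_swap tensm1.
Qed.

Lemma Theta_ract_ext : Theta ∘ ractS ∘ (Id SS ⊗₁ i) = ract SR ∘ (Theta ⊗₁ Id R).
Proof.
(* On representatives: [x ϑ(y i(r)) = x ϑ(y) r], by right [R]-linearity of [ϑ]. *)
apply: (coflat_tens_epi cR).
rewrite -[LHS]compA tens_swap !compA -[in LHS](compA Theta) SS_ractE.
rewrite -[RHS]compA -comp_tens1 !compA ThetaE comp_tens1 compA ractA.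
rewrite -!compA asso_nat -(tensm1 S S) asso_nat !compA.
rewrite -!(compA (ract SR)) -!tens1_comp.
by rewrite -(compA th) [th ∘ _](bim_right th).
Qed.

Lemma Theta'_ract : Theta' ∘ ractS = mul S ∘ (Theta' ⊗₁ Id S).
Proof.
apply: (coflat_tens_epi cS); rewrite -!compA SS_ractE -comp_tens1 !compA Theta'E.
rewrite comp_tens1 compA mul_lact -!compA; congr (_ ∘ (_ ∘ _)).
by rewrite asso_nat !compA -tens_swap tensm1.
Qed.

(** The Casimir identity along [i] gives [i(r) f1 ϑ(f2) = f1 ϑ(f2 i(r)) = f1 ϑ(f2) i(r)]. *)
Lemma Theta_central (f : hom 𝟙 SS) : casimir cS f ->
  mul S ∘ (i ⊗₁ (Theta ∘ f)) ∘ run' R = mul S ∘ ((Theta ∘ f) ⊗₁ i) ∘ lun' R.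
Proof.
move=> fC.
have -> : mul S ∘ (i ⊗₁ (Theta ∘ f)) ∘ run' R = Theta ∘ (lactS ∘ (Id S ⊗₁ f) ∘ run' S) ∘ i.
  rewrite !compA Theta_lact -!compA run'_nat; congr (_ ∘ _); rewrite !compA.
  by rewrite -!tensm_comp !compm1 !comp1m.
rewrite fC -!compA lun'_nat (compA (f ⊗₁ _)) -tens_swap !compA Theta_ract_ext /=.
by rewrite -!(compA (mul S)) -!tensm_comp !compm1 !comp1m.
Qed.

Lemma right_mul_Theta (f : hom 𝟙 SS) : casimir cS f ->
  right_mul (Theta ∘ f) = Theta ∘ ractS ∘ (f ⊗₁ Id S) ∘ lun' S.
Proof.
move=> fC; rewrite /right_mul tens1_comp !compA -Theta_lact -!compA.
by congr (_ ∘ (_ ∘ _)); rewrite !compA fC.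
Qed.

(** This linearity lets [u ϑ(v x) ⊗_R y] descend to the balanced product in [x] and [y]. *)
Lemma Theta_ract_linear :
  right_linear (tens_rmodule SS SR) SR (Theta ∘ ractS).
Proof.
rewrite /right_linear /= tens1_comp comp_tens1.
transitivity (Theta ∘ (ractS ∘ (Id SS ⊗₁ mul S) ∘ asso SS S S) ∘ (Id _ ⊗₁ i)).
  by rewrite -!compA -tensm1 asso_nat !compA.
rewrite -SS_ractA -(compA Theta) -(compA ractS) -tens_swap (compA ractS) (compA Theta).
by rewrite (compA Theta) Theta_ract_ext /= !(compA (mul S ∘ _)).
Qed.

Hypothesis rS : left_robust Q RS.

(** Up to an associator, [Id M ⊗₁ qS] is a quotient map followed by the isomorphism [theta'], so it
    is epic without any coflatness of [M]. *)
Lemma robust_tens_epi (M Z : C) (k k' : hom (M ⊗ SS) Z) :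
  k ∘ (Id M ⊗₁ qS) = k' ∘ (Id M ⊗₁ qS) -> k = k'.
Proof.
move=> E; have [t [_ tK]] := rS M SR.
apply: (split_epi tK); apply: tensR_epi.
by rewrite -!compA tensR_descE !compA E.
Qed.

(* [K : (u ⊗_R v) ⊗ (x ⊗_R y) ↦ u ϑ(v x) ⊗_R y]. Robustness makes
   [SS ⊗ SS] a quotient of [(SS ⊗ S) ⊗ S], where [K] is given by the formula. *)
Lemma contraction_exists : exists K : hom (SS ⊗ SS) SS,
  K ∘ (Id SS ⊗₁ qS) = qS ∘ ((Theta ∘ ractS) ⊗₁ Id S) ∘ asso' SS S S.
Proof.
have [t [Kt _]] := rS SS SR.
exists (hat Q RS Theta_ract_linear ∘ t).
apply: (split_epi (assoK' SS S S)); rewrite -!compA assoK compm1.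
transitivity (hat Q RS Theta_ract_linear ∘
    (t ∘ (theta' Q SS SR RS ∘ quo Q (tens_rmodule SS SR) RS))).
  by rewrite (tensR_descE Q (theta'_balanced Q SS SR RS)).
rewrite (compA t) Kt comp1m.
exact: (tensR_descE Q (hat_balanced Q RS Theta_ract_linear)).
Qed.

Section Contraction.
Variables (K : hom (SS ⊗ SS) SS).
Hypothesis KE :
  K ∘ (Id SS ⊗₁ qS) = qS ∘ ((Theta ∘ ractS) ⊗₁ Id S) ∘ asso' SS S S.

(** Since [u ϑ(v x) ⊗_R y = u ⊗_R ϑ(v x) y], [K] can also be computed by acting with [v] on the
    second argument and applying [Theta']. *)
Lemma contraction_lact :
  K ∘ (qS ⊗₁ Id SS) = qS ∘ (Id S ⊗₁ (Theta' ∘ lactS)) ∘ asso S S SS.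
Proof.
apply: robust_tens_epi.
transitivity (qS ∘ (Id S ⊗₁ (lact RS ∘ ((th ∘ mul S) ⊗₁ Id S))) ∘
    ((Id S ⊗₁ asso' S S S) ∘ asso S S (S ⊗ S))).
  rewrite -[LHS]compA -tens_swap compA KE.
  have -> : (Id S ⊗₁ asso' S S S) ∘ asso S S (S ⊗ S) =
      asso S (S ⊗ S) S ∘ (asso S S S ⊗₁ Id S) ∘ asso' (S ⊗ S) S S.
    apply: (split_epi (assoK' (S ⊗ S) S S)).
    rewrite -!compA assoK compm1 pentagon !compA -tens1_comp assoK tensm1.
    by rewrite comp1m.
  rewrite -[LHS]compA -tensm1 asso'_nat -[LHS]compA (compA _ _ (asso' _ _ _)).
  rewrite -comp_tens1 -(compA Theta) SS_ractE !(compA Theta) ThetaE.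
  rewrite -(compA (ract SR)) -tens1_comp (comp_tens1 _ _ (asso S S S)).
  rewrite -(compA _ (asso S S S ⊗₁ _)) compA qS_balanced.
  by rewrite -compA; congr (_ ∘ _); rewrite !compA.
rewrite -[RHS]compA -tensm1 asso_nat -[RHS](compA qS) [in RHS](compA (Id S ⊗₁ _)).
rewrite -tens1_comp -(compA Theta') SS_lactE !(compA Theta') Theta'E.
rewrite -(compA (lact RS)) -comp_tens1 tens1_comp.
by rewrite !tens1_comp !compA.
Qed.

(** By the Casimir identity of [f], [f1 ϑ(f2 x) ⊗_R y = x f1 ϑ(f2) ⊗_R y]. *)
Lemma contraction_left (f : hom 𝟙 SS) (gL : right_linear SR SR (right_mul (Theta ∘ f))) :
  casimir cS f -> K ∘ (f ⊗₁ Id SS) ∘ lun' SS = hat Q RS gL.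
Proof.
move=> fC; apply: tensR_epi; rewrite -/qS -/(Defs.SS Q i) hatE (right_mul_Theta fC).
rewrite -[LHS]compA lun'_nat -[LHS]compA (compA (f ⊗₁ _)) -tens_swap !(compA K) KE.
rewrite -[Id (SR ⊗ RS)]/(Id (S ⊗ S)) -tensm1 -[LHS]compA -(compA _ (asso' _ _ _)).
rewrite (compA (asso' _ _ _)) asso'_nat -(compA _ (asso' _ _ _)) lun'_tens.
by rewrite -(compA qS) -!comp_tens1 (compA (Theta ∘ ractS)).
Qed.

Lemma contraction_right (e : hom 𝟙 SS) : casimir cS e -> Theta' ∘ e = one S ->
  K ∘ (Id SS ⊗₁ e) ∘ run' SS = Id SS.
Proof.
move=> eC e1; apply: tensR_epi; rewrite -/qS -/(Defs.SS Q i) comp1m.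
(* [ϑ(v e1) e2 = ϑ(e1) e2 v = v], by the Casimir identity of [e] and then [e1]. *)
have E : Theta' ∘ lactS ∘ (Id S ⊗₁ e) ∘ run' S = Id S.
  rewrite -!(compA Theta') eC !(compA Theta') Theta'_ract.
  by rewrite -(compA (mul S)) -comp_tens1 e1 mul1 lunK'.
rewrite -[LHS]compA run'_nat -[LHS]compA (compA (Id SS ⊗₁ _)) tens_swap !(compA K).
rewrite contraction_lact.
rewrite -[Id (SR ⊗ RS)]/(Id (S ⊗ S)) -tensm1 -[LHS]compA -(compA _ (asso _ _ _)).
rewrite (compA (asso _ _ _)) asso_nat -(compA _ (asso _ _ _)) run'_tens.
by rewrite -(compA qS) -!tens1_comp (compA (Theta' ∘ lactS)) E tensm1 compm1.
Qed.

End Contraction.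

End FrobeniusSeparable.

Theorem corollary4p10 (C : MonoidalCategory) (Q : HasCoequalizers C)
    (R S : Algebra C) (i : AlgebraExtension R S)
    (cR : Coflat R) (cS : Coflat S) (rS : left_robust Q (ext_lmodule i))
    (th : BimoduleMorphism i) (e : hom 𝟙 (SS Q i))
    (frob : FrobeniusPair Q cS th e) :
  separable Q i cS <->
  exists (a0 : hom 𝟙 S)
         (Ha : mul S ∘ (i ⊗₁ a0) ∘ run' R = mul S ∘ (a0 ⊗₁ i) ∘ lun' R),
    mR Q i ∘ hat Q (ext_lmodule i) (right_mul_linear Ha) ∘ e = one S.
Proof.
have [eC _ eH] := frob; split=> [[f [fC f1]] | [a [Ha e1]]].
- have e1 : Theta' Q th ∘ e = one S.
    by rewrite -compA eH compA Upsilon'K' comp1m.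
  exists (Theta Q th ∘ f), (Theta_central cR th fC).
  have [K KE] := contraction_exists cR cS th rS.
  (* Evaluate [K] at [f ⊗ e] in two ways: fixing [f] gives [hat] of right multiplication by
     [Theta ∘ f], applied to [e]; fixing [e] gives [f]. The two unit insertions agree by
     [lun'_run'_unit]. *)
  rewrite -compA -(contraction_left KE _ fC) -!compA lun'_nat.
  rewrite (compA (f ⊗₁ _)) -tens_swap lun'_run'_unit -compA -run'_nat.
  by rewrite (compA (Id _ ⊗₁ e)) (compA K) (compA K) (contraction_right rS KE eC e1) comp1m.
- exists (hat Q (ext_lmodule i) (right_mul_linear Ha) ∘ e); split.
    exact: hat_casimir (right_mul_mul a) eC.
  by rewrite compA.
Qed.
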